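(* For all real coefficients $\alpha_0,\alpha_1,\alpha_2,\beta_0,\beta_1$, the deformed CMS operator $\mathcal{L}_{\bar n}=\sum_{k=0}^2\alpha_kD^k_{\bar n}+\sum_{\ell=0}^1\beta_\ell E^\ell_{\bar n}$ (acting in the variables $x$) and the operator $\bar{\mathcal{L}}_{\bar n,\bar m}=\sum_{k=0}^2\alpha_k\bar D^k_{\bar n,\bar m}+\sum_{\ell=0}^1\beta_\ell\bar E^\ell_{\bar n,\bar m}$ (acting in the variables $y$) satisfy $$\mathcal{L}_{\bar n,x}\Pi_{\bar n,\bar m}(x,y)=\bar{\mathcal{L}}_{\bar n,\bar m,y}\Pi_{\bar n,\bar m}(x,y).$$
   Context: Let $\bar n=(n,\tilde n)$, $\bar m=(m,\tilde m)$ be pairs of non-negative integers, $|\bar n|=n+\tilde n$, $|\bar m|=m+\tilde m$, $\theta$ a non-zero real parameter; $x=(x_1,\dots,x_{|\bar n|})$, $y=(y_1,\dots,y_{|\bar m|})$ independent variables (near the origin). Put $p(i)=0$ for $i\le n$, $p(i)=1$ for $n<i\le|\bar n|$; $q(j)=0$ for $j\le m$, $q(j)=1$ for $m<j\le|\bar m|$. Let $$\Pi_{\bar n,\bar m}(x,y)=\prod_{i=1}^{|\bar n|}\prod_{j=1}^{|\bar m|}(1-x_iy_j)^{(-\theta)^{1-p(i)-q(j)}}$$ (principal branch, i.e. binomial series). Put $n_\theta=\theta n-\tilde n$, $m_\theta=\theta m-\tilde m$, and $p_{r,\theta}(y)=\sum_{j=1}^my_j^r-\theta^{-1}\sum_{j=m+1}^{m+\tilde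 m}y_j^r$. For $\ell=0,1$ and $k=0,1,2$: $$E^\ell_{\bar n}=\sum_{i=1}^{|\bar n|}x_i^\ell\partial_{x_i},\qquad D^k_{\bar n}=\sum_{i}(-\theta)^{p(i)}x_i^k\partial_{x_i}^2-2\sum_{i\ne j}(-\theta)^{1-p(j)}\frac{x_i^k}{x_i-x_j}\partial_{x_i}+k\sum_i\bigl(1-(-\theta)^{1-p(i)}\bigr)x_i^{k-1}\partial_{x_i},$$ $$\bar E^\ell_{\bar n,\bar m}=\sum_{j=1}^{|\bar m|}y_j^{2-\ell}\partial_{y_j}+(1-\ell)n_\theta p_{1,\theta}(y),$$ $$\bar D^k_{\bar n,\bar m}=\sum_j(-\theta)^{q(j)}y_j^{4-k}\partial_{y_j}^2-2\sum_{j\ne l}(-\theta)^{1-q(l)}\frac{y_j^{4-k}}{y_j-y_l}\partial_{y_j}+\sum_jC_{j,k}y_j^{3-k}\partial_{y_j}+P_k(y),$$ where $$C_{j,k}=2(n_\theta-m_\theta)+(2-k)\bigl((-\theta)^{q(j)}-(-\theta)^{1-q(j)}\bigr)+k\bigl(1-(-\theta)^{1-q(j)}\bigr),$$ $$P_k(y)=(1-\delta_{k,2})n_\theta(n_\theta+1)p_{2-k,\theta}(y)+\delta_{k,0}\,\theta n_\theta\bigl(p_{1,\theta}(y)^2-p_{2,\theta}(y)\bigr).$$ Sums over $i\neq j$ and $j\neq l$ are over ordered pairs. *)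

(* Defs.v *)
From HB Require Import structures.
From mathcomp Require Import all_boot all_order all_algebra.
From mathcomp Require Import all_classical all_reals all_analysis.
From mathcomp Require Import complex.

Set Implicit Arguments.
Unset Strict Implicit.
Unset Printing Implicit Defensive.

Import Order.TTheory GRing.Theory Num.Theory.
Import numFieldNormedType.Exports.

Local Open Scope classical_set_scope.
Local Open Scope ring_scope.

Section DeformedCMS.
Variable K : numFieldType.
Implicit Types (theta a w : K) (n nt m mt k l r N : nat).

(* a (a - 1) ... (a - k + 1) / k! *)
Definition gbinom a k : K := \prod_(j < k) ((a - j%:R) / j.+1%:R).

(* Principal branch of w ^ a, as the binomial series at w = 1. Only meant for
   `|w - 1| < 1, where the series converges. *)
Definition ppow w a : K :=
  lim (series (fun k => gbinom a k * (w - 1) ^+ k) @ \oo).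

Definition partial N (i : 'I_N) (F : 'rV[K]_N -> K) : 'rV[K]_N -> K :=
  fun x => 'D_(delta_mx 0 i) F x.

(* With the indices numbered from 0, parity n is the function p of a pair
   (n, nt), and parity m is the function q of a pair (m, mt). *)
Definition parity n N (i : 'I_N) : nat := (n <= i)%N.

Definition Pi_kernel theta n nt m mt
    (x : 'rV[K]_(n + nt)) (y : 'rV[K]_(m + mt)) : K :=
  \prod_i \prod_j
    ppow (1 - x 0 i * y 0 j)
         ((- theta) ^ (1 - (parity n i)%:Z - (parity m j)%:Z)).

Definition sdim theta n nt : K := theta * n%:R - nt%:R.

(* Deformed power sum p_{r,theta}. *)
Definition dpsum theta m mt r (y : 'rV[K]_(m + mt)) : K :=
  \sum_(j < m) y 0 (lshift mt j) ^+ r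
  - theta^-1 * \sum_(j < mt) y 0 (rshift m j) ^+ r.

Definition E_op n nt l (F : 'rV[K]_(n + nt) -> K) : 'rV[K]_(n + nt) -> K :=
  fun x => \sum_i x 0 i ^+ l * partial i F x.

(* For k = 0 the truncated exponent k.-1 is harmless: the sum has factor 0. *)
Definition D_op theta n nt k (F : 'rV[K]_(n + nt) -> K) :
    'rV[K]_(n + nt) -> K :=
  fun x =>
    \sum_i (- theta) ^+ parity n i * x 0 i ^+ k * partial i (partial i F) x
  - 2 * \sum_i \sum_(j | j != i)
      (- theta) ^+ (1 - parity n j) * (x 0 i ^+ k / (x 0 i - x 0 j))
      * partial i F x
  + k%:R * \sum_i
      (1 - (- theta) ^+ (1 - parity n i)) * x 0 i ^+ k.-1 * partial i F x.

(* The natural-number subtractions below are exact in the range of use, l <= 1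
   and k <= 2. *)
Definition Ebar_op theta n nt m mt l (F : 'rV[K]_(m + mt) -> K) :
    'rV[K]_(m + mt) -> K :=
  fun y =>
    \sum_j y 0 j ^+ (2 - l) * partial j F y
  + (1 - l)%:R * sdim theta n nt * dpsum theta 1 y * F y.

Definition Dbar_coef theta n nt m mt k (j : 'I_(m + mt)) : K :=
    2 * (sdim theta n nt - sdim theta m mt)
  + (2 - k)%:R * ((- theta) ^+ parity m j - (- theta) ^+ (1 - parity m j))
  + k%:R * (1 - (- theta) ^+ (1 - parity m j)).

Definition Dbar_pot theta n nt m mt k (y : 'rV[K]_(m + mt)) : K :=
  let nth := sdim theta n nt in
    (k != 2)%:R * (nth * (nth + 1) * dpsum theta (2 - k) y)
  + (k == 0)%:R
      * (theta * nth * (dpsum theta 1 y ^+ 2 - dpsum theta 2 y)).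

Definition Dbar_op theta n nt m mt k (F : 'rV[K]_(m + mt) -> K) :
    'rV[K]_(m + mt) -> K :=
  fun y =>
    \sum_j (- theta) ^+ parity m j * y 0 j ^+ (4 - k)
      * partial j (partial j F) y
  - 2 * \sum_j \sum_(l | l != j)
      (- theta) ^+ (1 - parity m l) * (y 0 j ^+ (4 - k) / (y 0 j - y 0 l))
      * partial j F y
  + \sum_j Dbar_coef theta n nt k j * y 0 j ^+ (3 - k) * partial j F y
  + Dbar_pot theta n nt k y * F y.

Definition L_op theta (alpha : 'I_3 -> K) (beta : 'I_2 -> K) n nt
    (F : 'rV[K]_(n + nt) -> K) : 'rV[K]_(n + nt) -> K :=
  fun x => \sum_(k < 3) alpha k * D_op theta k F x
         + \sum_(l < 2) beta l * E_op l F x.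

Definition Lbar_op theta (alpha : 'I_3 -> K) (beta : 'I_2 -> K) n nt m mt
    (F : 'rV[K]_(m + mt) -> K) : 'rV[K]_(m + mt) -> K :=
  fun y => \sum_(k < 3) alpha k * Dbar_op theta n nt k F y
         + \sum_(l < 2) beta l * Ebar_op theta n nt l F y.

End DeformedCMS.

(* Main.v *)
Require Import Defs.
From HB Require Import structures.
From mathcomp Require Import all_boot all_order all_algebra.
From mathcomp Require Import all_classical all_reals all_analysis.
From mathcomp Require Import complex.
From mathcomp Require Import ring lra.

Set Implicit Arguments.
Unset Strict Implicit.
Unset Printing Implicit Defensive.

Import Order.TTheory GRing.Theory Num.Theory.
Import numFieldNormedType.Exports.

Local Open Scope complex_scope.
Local Open Scope ring_scope.

(** The kernel is a product of powers [(1 - x_i y_j) ^ e_ij], so every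
    derivative of it is the kernel times a rational function of [x] and [y],
    and the statement is an identity between two rational functions.

    Analysis.  The principal power is a binomial series.  Its coefficients grow
    subexponentially, which makes it converge in the open unit disc and makes
    the error of its first-order Taylor polynomial quadratic
    ([power_sum_remainder]); the recurrence of the binomial coefficients then
    says that [f(w) = w ^ a] satisfies [w f' = a f] ([binomial_series_ode]).
    Hence [is_derive_ppow], and, by the product rule, the first and second
    partial derivatives of the kernel ([partial_kernel], [partial2_kernel]).
    As the kernel is symmetric under exchanging [(n, nt, x)] with [(m, mt, y)],
    the [y]-derivatives need no separate computation.

    Algebra.  Put [t = - theta] and attach to each variable the weight
    [b_i = t ^ (1 - p(i))], [d_j = t ^ (1 - q(j))].  Then
    [e_ij = b_i d_j / t], [(- theta) ^ p(i) = t / b_i = 1 + t - b_i], and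
    [n_theta], [m_theta], [p_{r,theta}] are, up to sign and a factor [1 / t],
    the weighted power sums of the variables: all reference to the two kinds of
    variables disappears.  With [w_ij = y_j / (1 - x_i y_j)], the part of
    [D^k] without the first-order term [k (1 - b_i) x_i^(k-1)] becomes
    ([second_order_side_expand]) a sum over [j <> l] of [x_i^k w_ij w_il], a
    sum over pairs [(i, j)], and, after symmetrizing in [i <> i'], a sum of
    divided differences of [x^k w].  The dual operator has the same shape with
    the roles of [x] and [y] exchanged and [k] replaced by [4 - k].  The divided
    differences of one side equal the products of the other side
    ([quotient_x], [quotient_y]) up to terms whose sums collapse to sums over
    single pairs ([pair_sum_sym], [pair_sum_prod]); what is left is a sum over
    pairs [(i, j)] whose summand vanishes identically ([second_order_duality]).  The coefficients [C_{j,k}] and the potential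
    [P_k] are exactly what this last cancellation requires. *)

(** * The rational identity *)

Section PairSum.
Variables (F : fieldType) (I J : finType).
Implicit Types (b : I -> F) (d : J -> F).

(** The shape of the part of either side that involves two distinct variables
    of one family and one variable of the other. *)
Definition pair_sum b d (f : I -> I -> J -> F) : F :=
  \sum_i \sum_(i' | i' != i) \sum_j b i * b i' * d j * f i i' j.

Lemma eq_pair_sum b d f g :
  (forall i i' j, i' != i -> f i i' j = g i i' j) ->
  pair_sum b d f = pair_sum b d g.
Proof.
move=> fg; apply: eq_bigr => i _; apply: eq_bigr => i' ii'.
by apply: eq_bigr => j _; rewrite fg.
Qed.

Lemma pair_sum_swap b d f :
  pair_sum b d f = pair_sum b d (fun i i' j => f i' i j).
Proof.
rewrite /pair_sum (exchange_big_dep xpredT)//=.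
apply: eq_bigr => i _; apply: eq_big => [i'|i' _]; first by rewrite eq_sym.
by apply: eq_bigr => j _; rewrite [b i' * _]mulrC.
Qed.

Lemma pair_sum_exchange b d f :
  pair_sum b d f = \sum_j \sum_i \sum_(i' | i' != i) b i * b i' * d j * f i i' j.
Proof.
by rewrite /pair_sum; under eq_bigr do rewrite exchange_big; rewrite exchange_big.
Qed.

Lemma pair_sum_add b d f g :
  pair_sum b d (fun i i' j => f i i' j + g i i' j) = pair_sum b d f + pair_sum b d g.
Proof.
rewrite -big_split /=; apply: eq_bigr => i _.
rewrite -big_split /=; apply: eq_bigr => i' _.
by rewrite -big_split /=; apply: eq_bigr => j _; rewrite mulrDr.
Qed.

Lemma pair_sum_opp b d f :
  pair_sum b d (fun i i' j => - f i i' j) = - pair_sum b d f.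
Proof.
rewrite -sumrN; apply: eq_bigr => i _; rewrite -sumrN; apply: eq_bigr => i' _.
by rewrite -sumrN; apply: eq_bigr => j _; rewrite mulrN.
Qed.

(** Completing the inner sum to all indices separates the variables, so a
    product collapses to a sum over single pairs [(i, j)]. *)
Lemma pair_sum_prod b d (p q : I -> J -> F) :
  pair_sum b d (fun i i' j => p i j * q i' j)
  = \sum_i \sum_j b i * d j * (p i j * (\sum_i' b i' * q i' j - b i * q i j)).
Proof.
apply: eq_bigr => i _; rewrite exchange_big /=; apply: eq_bigr => j _.
rewrite [in RHS](bigD1 i)//= [X in X - _]addrC addrK.
by rewrite !mulr_sumr; apply: eq_bigr => i' _; ring.
Qed.

(** Symmetric summands that see only one variable of each family at a time
    collapse as well; the total weight appears, later read as [- n_theta] or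
    [- m_theta]. *)
Lemma pair_sum_sym b d (f : I -> J -> F) :
  pair_sum b d (fun i i' j => f i j + f i' j)
  = \sum_i \sum_j b i * d j * (2 * (\sum_i' b i' - b i) * f i j).
Proof.
rewrite pair_sum_add [X in _ + X]pair_sum_swap.
have -> : pair_sum b d (fun i _ j => f i j) = pair_sum b d (fun i i' j => f i j * 1).
  by apply: eq_pair_sum => *; rewrite mulr1.
rewrite (pair_sum_prod b d f (fun _ _ => 1)) -big_split /=; apply: eq_bigr => i _.
rewrite -big_split /=; apply: eq_bigr => j _.
have -> : \sum_i' b i' * 1 = \sum_i' b i' by apply: eq_bigr => i' _; rewrite mulr1.
by ring.
Qed.

End PairSum.

Section Duality.
Variable F : fieldType.

(** The divided difference of [x^k w] produced by the operator in [x] against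
    the product of two factors [x / (1 - x y)] produced by the operator in [y]:
    the relation [x y v = v - 1], where [v = 1 / (1 - x y)], turns their
    difference into terms that see only one of [x], [x']. *)
Lemma quotient_x k (x x' y : F) : (k < 3)%N ->
  x != x' -> 1 - x * y != 0 -> 1 - x' * y != 0 ->
  (x ^+ k * (y / (1 - x * y)) - x' ^+ k * (y / (1 - x' * y))) / (x - x')
  - y ^+ (4 - k) * (x / (1 - y * x)) * (x' / (1 - y * x'))
  = y ^+ (2 - k) / (1 - x * y) + y ^+ (2 - k) / (1 - x' * y)
    - (y ^+ (2 - k) + (k == 2)%:R).
Proof.
rewrite -subr_eq0 ![y * _]mulrC => k3 xx xy x'y.
by case: k k3 => [|[|[|]]]//= _; field; apply/and3P.
Qed.

(** The counterpart of [quotient_x] for two variables of the other family.  The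
    exponent [4 - k] leaves, for [k = 0], a mixed term [y y']; it is the source
    of the summand [p_1 ^ 2 - p_2] of the potential. *)
Lemma quotient_y k (x y y' : F) : (k < 3)%N ->
  y != y' -> 1 - x * y != 0 -> 1 - x * y' != 0 ->
  (y ^+ (4 - k) * (x / (1 - y * x)) - y' ^+ (4 - k) * (x / (1 - y' * x))) / (y - y')
  - x ^+ k * (y / (1 - x * y)) * (y' / (1 - x * y'))
  = y ^+ (2 - k) * ((1 - x * y)^-1 - 1) + y' ^+ (2 - k) * ((1 - x * y')^-1 - 1)
    - (k == 0)%:R * y * y'.
Proof.
rewrite -subr_eq0 ![_ * x]mulrC => k3 xx xy x'y.
by case: k k3 => [|[|[|]]]//= _; field; apply/and3P.
Qed.

(** The logarithmic [x_i]-derivative of the product of the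
    [(1 - x_i y_j) ^ (b_i d_j / t)]. *)
Definition log_deriv (I J : finType) (t : F) (b : I -> F) (d : J -> F) x y
    (i : I) :=
  \sum_(j : J) - (b i * d j / t) * (y j / (1 - x i * y j)).

(** What the second-order and the two-particle terms of [D^k] become after
    division by the kernel; the same formula with the two families exchanged
    and [4 - k] for [k] serves the dual operator. *)
Definition second_order_side (I J : finType) (t : F) (b : I -> F) (d : J -> F)
    x y k :=
  \sum_i t / b i * x i ^+ k
     * (log_deriv t b d x y i ^+ 2
        + \sum_j - (b i * d j / t) * (y j / (1 - x i * y j)) ^+ 2)
  - 2 * \sum_i \sum_(i' | i' != i)
      b i' * (x i ^+ k / (x i - x i')) * log_deriv t b d x y i.

(** The off-diagonal part of the squared logarithmic derivative gives the first
    summand, its diagonal part merges with the derivative of the logarithmic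
    derivative into the second, where [t / b = 1 + t - b] makes the coefficient
    symmetric in the two families, and antisymmetry of [1 / (x_i - x_i')] turns
    the two-particle term into divided differences. *)
Lemma second_order_side_expand (I J : finType) (t : F) (b : I -> F) (d : J -> F)
    x y k :
  t != 0 -> (forall i, b i != 0) -> (forall i, t / b i = 1 + t - b i) ->
  (forall i i', i != i' -> x i != x i') ->
  t * second_order_side t b d x y k
  = pair_sum d b (fun j l i => x i ^+ k * (y j / (1 - x i * y j))
                           * (y l / (1 - x i * y l)))
  + \sum_i \sum_j b i * d j
      * ((b i + d j - 1 - t) * (x i ^+ k * (y j / (1 - x i * y j)) ^+ 2))
  + pair_sum b d (fun i i' j => (x i ^+ k * (y j / (1 - x i * y j))
       - x i' ^+ k * (y j / (1 - x i' * y j))) / (x i - x i')).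
Proof.
move=> t0 b0 bt xx; pose w i j := y j / (1 - x i * y j).
have uE i : log_deriv t b d x y i = - (b i / t) * \sum_j d j * w i j.
  by rewrite mulr_sumr; apply: eq_bigr => j _; rewrite /w; ring.
rewrite /second_order_side mulrBr; congr (_ + _).
  rewrite mulr_sumr pair_sum_exchange -big_split /=; apply: eq_bigr => i _.
  rewrite -big_split /= uE.
  have -> : t * (t / b i * x i ^+ k * ((- (b i / t) * \sum_j d j * w i j) ^+ 2
       + \sum_j - (b i * d j / t) * (y j / (1 - x i * y j)) ^+ 2))
    = b i * x i ^+ k * ((\sum_j d j * w i j) * (\sum_j d j * w i j)
       - (1 + t - b i) * \sum_j d j * w i j ^+ 2).
    rewrite -bt.
    have -> : \sum_j - (b i * d j / t) * (y j / (1 - x i * y j)) ^+ 2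
      = - (b i / t) * \sum_j d j * w i j ^+ 2.
      by rewrite mulr_sumr; apply: eq_bigr => j _; rewrite /w; ring.
    by field; rewrite t0 b0.
  rewrite mulr_suml mulr_sumr -sumrB mulr_sumr; apply: eq_bigr => j _.
  rewrite (bigD1 j)//=; set S := \sum_(l | _) _.
  have -> : \sum_(l | l != j) d j * d l * b i * (x i ^+ k
      * (y j / (1 - x i * y j)) * (y l / (1 - x i * y l)))
    = b i * x i ^+ k * (d j * w i j) * S.
    by rewrite mulr_sumr; apply: eq_bigr => l _; rewrite /w; ring.
  rewrite -/(w i j); ring.
pose g i i' j := x i ^+ k * w i j / (x i - x i').
have -> : pair_sum b d (fun i i' j => (x i ^+ k * (y j / (1 - x i * y j))
       - x i' ^+ k * (y j / (1 - x i' * y j))) / (x i - x i'))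
   = pair_sum b d (fun i i' j => g i i' j + g i' i j).
  apply: eq_pair_sum => i i' j /xx; rewrite eq_sym -subr_eq0 => ne.
  rewrite /g -/(w i j) -/(w i' j) mulrBl -(opprB (x i)) invrN mulrN; ring.
rewrite pair_sum_add -[X in _ + X]pair_sum_swap.
set S := \sum_i _; have -> : - (t * (2 * S)) = 2 * - (t * S) by ring.
rewrite -mulr2n -[RHS]mulr_natl; congr (2 * _); rewrite /S.
rewrite mulr_sumr -sumrN; apply: eq_bigr => i _.
rewrite mulr_sumr -sumrN; apply: eq_bigr => i' _.
rewrite uE; set c := _ / (_ - _); set T := \sum_j _.
have -> : - (t * (b i' * c * (- (b i / t) * T))) = b i * b i' * c * T.
  by field; rewrite t0.
by rewrite mulr_sumr; apply: eq_bigr => j _; rewrite /g /c; ring.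
Qed.

(** Both sides, multiplied by [t] and expanded, differ only by sums over pairs
    [(i, j)]: [quotient_x] and [quotient_y] match the divided differences of
    each side with the products of the other. *)
Lemma second_order_duality (I J : finType) (t : F) (b : I -> F) (d : J -> F)
    x y k :
  (k < 3)%N ->
  t != 0 -> (forall i, b i != 0) -> (forall i, t / b i = 1 + t - b i) ->
  (forall j, d j != 0) -> (forall j, t / d j = 1 + t - d j) ->
  (forall i i', i != i' -> x i != x i') ->
  (forall j l, j != l -> y j != y l) ->
  (forall i j, 1 - x i * y j != 0) ->
  let B := \sum_i b i in let D := \sum_j d j in
  let Dr r := \sum_j d j * y j ^+ r in
  second_order_side t b d x y k
    + k%:R * \sum_i (1 - b i) * x i ^+ k.-1 * log_deriv t b d x y i
  = second_order_side t d b y x (4 - k)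
    + \sum_j (2 * (D - B) + (2 - k)%:R * (1 + t - d j - d j)
              + k%:R * (1 - d j)) * y j ^+ (3 - k) * log_deriv t d b y x j
    + ((k != 2)%:R * (B * (B - 1) * (Dr (2 - k)%N / t))
       + (k == 0)%:R * (B * (Dr 1 ^+ 2 / t - Dr 2))).
Proof.
move=> k3 t0 b0 bt d0 dt xx yy xy B D Dr; apply: (mulfI t0).
rewrite [LHS]mulrDr [RHS]mulrDr [X in _ = X + _]mulrDr !second_order_side_expand//.
pose r := (2 - k)%N; pose v i j := (1 - x i * y j)^-1.
(* the sums over two distinct [x]-variables *)
have TI : pair_sum b d (fun i i' j => (x i ^+ k * (y j / (1 - x i * y j))
       - x i' ^+ k * (y j / (1 - x i' * y j))) / (x i - x i'))
   - pair_sum b d (fun i i' j => y j ^+ (4 - k) * (x i / (1 - y j * x i))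
                           * (x i' / (1 - y j * x i')))
   = \sum_i \sum_j b i * d j * (2 * (B - b i) * (y j ^+ r * v i j)
       - (B - b i) * (y j ^+ r + (k == 2)%:R)).
  under [RHS]eq_bigr do under eq_bigr do rewrite mulrBr.
  under [RHS]eq_bigr do rewrite sumrB.
  rewrite sumrB -pair_sum_sym.
  have -> : \sum_i \sum_j b i * d j * ((B - b i) * (y j ^+ r + (k == 2)%:R))
    = pair_sum b d (fun i i' j => (y j ^+ r + (k == 2)%:R) * 1).
    rewrite (pair_sum_prod b d (fun _ j => (y j ^+ r + (k == 2)%:R)) (fun _ _ => 1)).
    apply: eq_bigr => i _; apply: eq_bigr => j _.
    have -> : \sum_i' b i' * 1 = B by apply: eq_bigr => *; rewrite mulr1.
    by ring.
  rewrite -!pair_sum_opp -!pair_sum_add; apply: eq_pair_sum => i i' j ii'.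
  by rewrite quotient_x ?xx// 1?eq_sym// mulr1.
(* the sums over two distinct [y]-variables *)
have TJ : pair_sum d b (fun j l i => (y j ^+ (4 - k) * (x i / (1 - y j * x i))
       - y l ^+ (4 - k) * (x i / (1 - y l * x i))) / (y j - y l))
   - pair_sum d b (fun j l i => x i ^+ k * (y j / (1 - x i * y j))
                           * (y l / (1 - x i * y l)))
   = \sum_i \sum_j b i * d j * (2 * (D - d j) * (y j ^+ r * (v i j - 1))
                             - (k == 0)%:R * (y j * (Dr 1 - d j * y j))).
  under [RHS]eq_bigr do under eq_bigr do rewrite mulrBr.
  under [RHS]eq_bigr do rewrite sumrB.
  rewrite sumrB [X in _ = X - _]exchange_big [X in _ = _ - X]exchange_big /=.
  under [X in _ = X - _]eq_bigr do under eq_bigr do rewrite [b _ * _]mulrC.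
  under [X in _ = _ - X]eq_bigr do under eq_bigr do rewrite [b _ * _]mulrC.
  rewrite -(pair_sum_sym d b (fun j i => y j ^+ r * (v i j - 1))).
  have -> : \sum_j \sum_i d j * b i * ((k == 0)%:R * (y j * (Dr 1 - d j * y j)))
    = pair_sum d b (fun j l i => ((k == 0)%:R * y j) * y l).
    rewrite (pair_sum_prod d b (fun j _ => (k == 0)%:R * y j) (fun l _ => y l)).
    apply: eq_bigr => j _; apply: eq_bigr => i _.
    have -> : \sum_l d l * y l = Dr 1%N by apply: eq_bigr => *; rewrite expr1.
    by rewrite !mulrA.
  rewrite -!pair_sum_opp -!pair_sum_add; apply: eq_pair_sum => j l i jl.
  by rewrite quotient_y ?yy// eq_sym.
(* the remaining terms are sums over pairs already; the constants of the
   potential are spread over the pairs by reading [B] as a sum over [i] *)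
have E3 : t * (k%:R * \sum_i (1 - b i) * x i ^+ k.-1 * log_deriv t b d x y i)
    = \sum_i \sum_j b i * d j * - (k%:R * (1 - b i) * x i ^+ k.-1 * (y j * v i j)).
  rewrite mulr_sumr mulr_sumr; apply: eq_bigr => i _; rewrite /log_deriv !mulr_sumr.
  by apply: eq_bigr => j _; rewrite /v; set V := (1 - _)^-1; field.
have EC : t * \sum_j (2 * (D - B) + (2 - k)%:R * (1 + t - d j - d j)
              + k%:R * (1 - d j)) * y j ^+ (3 - k) * log_deriv t d b y x j
    = \sum_i \sum_j b i * d j * - ((2 * (D - B) + (2 - k)%:R * (1 + t - d j - d j)
              + k%:R * (1 - d j)) * y j ^+ (3 - k) * (x i * v i j)).
  rewrite mulr_sumr exchange_big; apply: eq_bigr => j _; rewrite /log_deriv !mulr_sumr.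
  apply: eq_bigr => i _; rewrite /v [y j * _]mulrC; set V := (1 - _)^-1.
  by set c := (_ + _ + _); field.
have EP : t * ((k != 2)%:R * (B * (B - 1) * (Dr (2 - k)%N / t))
       + (k == 0)%:R * (B * (Dr 1 ^+ 2 / t - Dr 2)))
    = \sum_i \sum_j b i * d j * ((k != 2)%:R * (B - 1) * y j ^+ (2 - k)
        + (k == 0)%:R * (y j * (Dr 1 - t * y j))).
  have inner (g : J -> F) : \sum_i \sum_j b i * d j * g j = B * \sum_j d j * g j.
    rewrite mulr_suml; apply: eq_bigr => i _; rewrite mulr_sumr.
    by apply: eq_bigr => j _; rewrite mulrA.
  rewrite inner.
  have -> : \sum_j d j * ((k != 2)%:R * (B - 1) * y j ^+ (2 - k)
        + (k == 0)%:R * (y j * (Dr 1 - t * y j)))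
    = (k != 2)%:R * (B - 1) * Dr (2 - k)%N
      + (k == 0)%:R * (Dr 1 * Dr 1 - t * Dr 2).
    have DrE s : Dr s = \sum_j d j * y j ^+ s by [].
    rewrite (DrE (2 - k)%N) (DrE 2%N) {3}(DrE 1%N) !mulr_sumr -sumrB mulr_sumr.
    rewrite -big_split /=.
    by apply: eq_bigr => j _; rewrite expr1; ring.
  by field.
have ES : \sum_i \sum_j d i * b j * ((d i + b j - 1 - t)
      * (y i ^+ (4 - k) * (x j / (1 - y i * x j)) ^+ 2))
    = \sum_i \sum_j b i * d j * ((b i + d j - 1 - t)
      * (y j ^+ (4 - k) * (x i * v i j) ^+ 2)).
  rewrite exchange_big; apply: eq_bigr => i _; apply: eq_bigr => j _.
  by rewrite /v [y j * _]mulrC; ring.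
rewrite E3 EC EP ES.
suff : \sum_i \sum_j b i * d j * ((b i + d j - 1 - t)
      * (x i ^+ k * (y j / (1 - x i * y j)) ^+ 2))
   + \sum_i \sum_j b i * d j * (2 * (B - b i) * (y j ^+ r * v i j)
       - (B - b i) * (y j ^+ r + (k == 2)%:R))
   + \sum_i \sum_j b i * d j * - (k%:R * (1 - b i) * x i ^+ k.-1 * (y j * v i j))
   = \sum_i \sum_j b i * d j * ((b i + d j - 1 - t)
      * (y j ^+ (4 - k) * (x i * v i j) ^+ 2))
   + \sum_i \sum_j b i * d j * (2 * (D - d j) * (y j ^+ r * (v i j - 1))
                             - (k == 0)%:R * (y j * (Dr 1 - d j * y j)))
   + \sum_i \sum_j b i * d j * - ((2 * (D - B) + (2 - k)%:R * (1 + t - d j - d j)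
              + k%:R * (1 - d j)) * y j ^+ (3 - k) * (x i * v i j))
   + \sum_i \sum_j b i * d j * ((k != 2)%:R * (B - 1) * y j ^+ (2 - k)
        + (k == 0)%:R * (y j * (Dr 1 - t * y j))).
  rewrite -TI -TJ => H.
  have {}H := congr1 (fun z => z + (pair_sum d b (fun j l i => x i ^+ k
    * (y j / (1 - x i * y j)) * (y l / (1 - x i * y l)))
    + pair_sum b d (fun i i' j => y j ^+ (4 - k) * (x i / (1 - y j * x i))
                              * (x i' / (1 - y j * x i'))))) H.
  move: H => /=; set A1 := pair_sum _ _ _; set A2 := pair_sum _ _ _; set A3 := pair_sum _ _ _.
  by set A4 := pair_sum _ _ _ => H; apply: (etrans _ (etrans H _)); ring.
rewrite -!big_split /=; apply: eq_bigr => i _.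
rewrite -!big_split /=; apply: eq_bigr => j _.
rewrite /v /r; clear TI TJ E3 EC EP ES r; have := xy i j.
have -> : (2 - k)%:R = 2 - k%:R :> F by rewrite natrB.
by case: k k3 => [|[|[|]]]//= _ *; field.
Qed.

(** With [v = 1 / (1 - x y)], both summands contain [x y v] for [l = 1], while
    for [l = 0] the relation [y^2 x v = y v - y] leaves [- y], which adds up to
    the term with [p_1]. *)
Lemma first_order_duality (I J : finType) (t : F) (b : I -> F) (d : J -> F)
    x y l :
  (l < 2)%N -> t != 0 -> (forall i j, 1 - x i * y j != 0) ->
  \sum_i x i ^+ l * log_deriv t b d x y i
  = \sum_j y j ^+ (2 - l) * log_deriv t d b y x j
    + (1 - l)%:R * ((- \sum_i b i) * (\sum_j d j * y j / t)).
Proof.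
move=> l2 t0 xy.
have -> : (- \sum_i b i) * (\sum_j d j * y j / t)
    = \sum_j \sum_i - (b i * (d j * y j / t)).
  rewrite exchange_big mulNr mulr_suml -sumrN; apply: eq_bigr => i _.
  by rewrite mulr_sumr -sumrN.
rewrite mulr_sumr -big_split /= /log_deriv.
under eq_bigr do rewrite mulr_sumr.
rewrite exchange_big /=; apply: eq_bigr => j _.
rewrite !mulr_sumr -big_split /=; apply: eq_bigr => i _.
have := xy i j; rewrite [x i * _]mulrC.
have -> : (1 - l)%:R = 1 - l%:R :> F by rewrite natrB.
by case: l l2 => [|[|]]//= _ ne; field; rewrite t0.
Qed.

End Duality.

Section ComplexKernel.
Local Open Scope classical_set_scope.
Import ComplexField.Normc.
Variable R : realType.
Local Notation C := (R[i] : numFieldType).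
Local Notation nm := (@normc R).
Local Notation Re := (@complex.Re R).
Local Notation Im := (@complex.Im R).

(** * Power series over the complex numbers *)

(** Estimates are carried out on the real-valued modulus, since the norm of the
    field [R[i]] takes its values in the partially ordered [R[i]] itself. *)
Lemma normE (z : C) : `|z| = (nm z)%:C.
Proof. by []. Qed.

Lemma nm_ge0 (z : C) : 0 <= nm z.
Proof. by rewrite -ler0c -normE. Qed.

Lemma nmX (z : C) k : nm (z ^+ k) = nm z ^+ k.
Proof. by apply: complexI; rewrite -normE normrX normE rmorphXn. Qed.

Lemma nm_nat k : nm k%:R = k%:R.
Proof. by apply: complexI; rewrite -normE normr_nat rmorph_nat. Qed.

Lemma nm_sum (u : nat -> C) N :
  nm (\sum_(0 <= k < N) u k) <= \sum_(0 <= k < N) nm (u k).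
Proof.
elim: N => [|N IH]; first by rewrite !big_geq// normc0.
by rewrite !big_nat_recr//=; apply: le_trans (le_normcD _ _) _; rewrite lerD2r.
Qed.

Lemma geometric_sum_le (M q : R) N :
  0 <= M -> 0 <= q < 1 -> \sum_(0 <= k < N) M * q ^+ k <= M / (1 - q).
Proof.
move=> M0 /andP[q0 q1]; rewrite -mulr_sumr ler_wpM2l //.
have q1' : 0 < 1 - q by rewrite subr_gt0.
rewrite -[leRHS]mul1r ler_pdivlMr //.
have -> : (\sum_(0 <= k < N) q ^+ k) * (1 - q) = 1 - q ^+ N.
  by rewrite big_mkord -[in RHS](expr1n _ N) subrXX mulrC; congr (_ * _);
    apply: eq_bigr => i _; rewrite expr1n mul1r.
by rewrite lerBlDr lerDl exprn_ge0.
Qed.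

Lemma nm_le_ReIm (z : C) : nm z <= `|Re z| + `|Im z|.
Proof.
case: z => a b /=; rewrite -(ler_pXn2r (n:=2)) ?nnegrE ?addr_ge0 ?sqrtr_ge0//.
rewrite sqr_sqrtr ?addr_ge0 ?sqr_ge0// sqrrD !real_normK ?num_real//.
by rewrite lerD2r lerDl mulrn_wge0// mulr_ge0.
Qed.

Lemma ReIm_le_nm (z : C) : `|Re z| <= nm z /\ `|Im z| <= nm z.
Proof.
by case: z => a b /=; split; rewrite -sqrtr_sqr ler_wsqrtr // ?lerDl ?lerDr sqr_ge0.
Qed.

Lemma cvg_complex (u : C^nat) (a b : R) :
  (fun k => Re (u k)) @ \oo --> a -> (fun k => Im (u k)) @ \oo --> b ->
  u @ \oo --> (a +i* b : C).
Proof.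
move=> ua ub; apply/cvgrPdist_lt => e; rewrite ltcE => /andP[/eqP/= eI eR].
have -> : e = (Re e)%:C by apply/eqP; rewrite eq_complex /= eqxx -eI /= eqxx.
have e2 : 0 < Re e / 2 by rewrite divr_gt0.
near=> n; rewrite normE ltcR.
apply: le_lt_trans (nm_le_ReIm _) _.
rewrite (splitr (Re e)); apply: ltrD.
  suff -> : Re ((a +i* b)%C - u n) = a - Re (u n) by near: n; apply: cvgr_dist_lt.
  by case: (u n).
suff -> : Im ((a +i* b)%C - u n) = b - Im (u n) by near: n; apply: cvgr_dist_lt.
by case: (u n).
Unshelve. all: by end_near. Qed.

(** Completeness enters here, through that of [R] applied to the real and
    imaginary parts. *)
Lemma cvg_dominated_series (u : C^nat) (M q : R) :
  0 <= q < 1 -> (forall k, nm (u k) <= M * q ^+ k) -> cvgn (series u).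
Proof.
move=> q01 uM.
have M0 : 0 <= M by have := uM 0; rewrite expr0 mulr1; apply: le_trans; exact: nm_ge0.
have /andP[q0 q1] := q01.
have cvM : cvgn (series (fun k => M * q ^+ k)).
  by apply: is_cvg_geometric_series; rewrite ger0_norm.
have cvR (f : C -> R) : (forall z, `|f z| <= nm z) -> cvgn (series (f \o u)).
  move=> fn; apply: normed_cvg; apply: series_le_cvg cvM => k /=.
  - exact: normr_ge0.
  - by rewrite mulr_ge0 ?exprn_ge0.
  - exact: le_trans (fn _) (uM k).
have cRe := cvR Re (fun z => (ReIm_le_nm z).1).
have cIm := cvR Im (fun z => (ReIm_le_nm z).2).
apply/cvg_ex; eexists; apply: cvg_complex.
  have -> : (fun k => Re (series u k)) = series (Re \o u); last exact: cRe.
  by apply/funext => n; apply: (big_morph Re (op1 := +%R)) => // -[? ?] [? ?].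
have -> : (fun k => Im (series u k)) = series (Im \o u); last exact: cIm.
by apply/funext => n; apply: (big_morph Im (op1 := +%R)) => // -[? ?] [? ?].
Qed.

Lemma nm_lim_le (u : C^nat) (l : C) (M : R) :
  u @ \oo --> l -> (forall n, nm (u n) <= M) -> nm l <= M.
Proof.
move=> ul uM; rewrite leNgt; apply/negP => Ml.
have e0 : 0 < (nm l - M)%:C by rewrite ltcR subr_gt0.
move/cvgrPdist_lt : ul => /(_ _ e0)[N _ /(_ N (leqnn N))] /=.
rewrite normE ltcR => lt; have := le_normcD (l - u N) (u N); rewrite subrK.
have := uM N; lra.
Qed.

(** Equivalently, the radius of convergence of the power series is at least 1.
    Boundedness, rather than convergence, is what the recurrences give
    directly. *)
Definition subexponential (c : nat -> C) :=
  forall s : R, 0 < s < 1 -> exists M : R, forall k, nm (c k) * s ^+ k <= M.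

(** Bernoulli's inequality bounds [k (s / t) ^ k] for [s < t < 1]. *)
Lemma subexponential_mulk c :
  subexponential c -> subexponential (fun k => k%:R * c k).
Proof.
move=> hc s /andP[s0 s1]; pose t := (s + 1) / 2.
have t0 : 0 < t by rewrite /t; lra.
have t1 : t < 1 by rewrite /t; lra.
have st : s < t by rewrite /t; lra.
have [|M cM] := hc t; first by rewrite t0 t1.
have M0 : 0 <= M by have := cM 0; rewrite expr0 mulr1; apply: le_trans; exact: nm_ge0.
pose q := t / s - 1.
have q0 : 0 < q by rewrite subr_gt0 ltr_pdivlMr// mul1r.
exists (M / q) => k; rewrite normcM nm_nat.
have -> : s ^+ k = t ^+ k * (t / s) ^- k.
  by rewrite -exprVn invf_div -exprMn mulrC divfK// gt_eqF.
rewrite [k%:R * _]mulrC mulrACA; apply: ler_pM => //.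
- by rewrite mulr_ge0 ?nm_ge0 ?exprn_ge0// ltW.
- by rewrite divr_ge0// exprn_ge0// divr_ge0// ltW.
have ts0 : 0 < t / s by rewrite divr_gt0.
rewrite ler_pdivrMr ?exprn_gt0// mulrC ler_pdivlMr//.
have : 1 + k%:R * q <= (t / s) ^+ k.
  have -> : t / s = 1 + q by rewrite /q; ring.
  elim: k => [|k IH]; first by rewrite expr0 mul0r addr0.
  rewrite exprS; apply: le_trans (_ : (1 + q) * (1 + k%:R * q) <= _).
    rewrite -natr1; have : 0 <= (k%:R : R) by []; nra.
  by rewrite ler_wpM2l// addr_ge0// ltW.
lra.
Qed.

Lemma subexponential_shift c :
  subexponential c -> subexponential (fun k => c k.+1).
Proof.
move=> hc s s01; have [M cM] := hc s s01; have /andP[s0 s1] := s01.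
by exists (M / s) => k; rewrite ler_pdivlMr// -mulrA -exprSr.
Qed.

Lemma cvg_power_series c (z : C) :
  subexponential c -> nm z < 1 -> cvgn (series (fun k => c k * z ^+ k)).
Proof.
move=> hc z1; have z0 := nm_ge0 z; pose s := (nm z + 1) / 2.
have s0 : 0 < s by rewrite /s; lra.
have [|M cM] := hc s; first by rewrite /s; lra.
apply: (@cvg_dominated_series _ M (nm z / s)).
  by rewrite divr_ge0 ?(ltW s0)//= ltr_pdivrMr// mul1r /s; lra.
move=> k; rewrite normcM nmX expr_div_n mulrA.
rewrite ler_pdivlMr ?exprn_gt0// mulrAC ler_wpM2r// exprn_ge0//.
Qed.

(** The remainder [T_k] obeys [T_(k+1) = (z + h) T_k + k z ^ (k-1) h ^ 2].  The
    factor [r ^ 2] on the left avoids the exponent [k - 2] on the right. *)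
Lemma power_remainder (z h : C) (r : R) k :
  nm z <= r -> nm (z + h) <= r ->
  r ^+ 2 * nm ((z + h) ^+ k - z ^+ k - h * (k%:R * z ^+ k.-1))
    <= k%:R ^+ 2 * r ^+ k * nm h ^+ 2.
Proof.
move=> zr zhr; have r0 : 0 <= r := le_trans (nm_ge0 _) zr.
have h0 := nm_ge0 h; have h20 : 0 <= nm h ^+ 2 by rewrite exprn_ge0.
elim: k => [|k IH].
  by rewrite !expr0 subrr mul0r mulr0 subrr normc0 mulr0 expr0n /= !mul0r.
set T := _ - _ - _ in IH.
have -> : (z + h) ^+ k.+1 - z ^+ k.+1 - h * (k.+1%:R * z ^+ k)
    = (z + h) * T + h ^+ 2 * (k%:R * z ^+ k.-1).
  rewrite /T !exprS -natr1; case: (k) => [|j] /=; first by rewrite !expr0; ring.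
  by rewrite !exprS; ring.
have A : r ^+ 2 * nm ((z + h) * T) <= k%:R ^+ 2 * r ^+ k.+1 * nm h ^+ 2.
  rewrite normcM mulrCA.
  have -> : k%:R ^+ 2 * r ^+ k.+1 * nm h ^+ 2 = r * (k%:R ^+ 2 * r ^+ k * nm h ^+ 2).
    by rewrite [r ^+ _]exprS; ring.
  by apply: ler_pM => //; rewrite ?mulr_ge0 ?exprn_ge0 ?nm_ge0.
have B : r ^+ 2 * nm (h ^+ 2 * (k%:R * z ^+ k.-1)) <= k%:R * r ^+ k.+1 * nm h ^+ 2.
  case: (k) => [|j]; first by rewrite !mul0r mulr0 normc0 mulr0.
  rewrite !normcM !nmX nm_nat /= mulrCA [leRHS]mulrC ler_wpM2l //.
  rewrite mulrCA ler_wpM2l // -[j.+2]addn2 exprD mulrC ler_wpM2r ?exprn_ge0//.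
  by rewrite lerXn2r// nnegrE nm_ge0.
apply: le_trans (ler_wpM2l _ (le_normcD _ _)) _; first by rewrite exprn_ge0.
rewrite mulrDr; apply: le_trans (lerD A B) _.
rewrite -mulrDl ler_wpM2r// -mulrDl ler_wpM2r ?exprn_ge0//.
rewrite -natr1; have : 0 <= (k%:R : R) by []; nra.
Qed.

Definition power_sum (c : nat -> C) (z : C) : C :=
  limn (series (fun k => c k * z ^+ k)).

Definition deriv_coef (c : nat -> C) (k : nat) : C := k.+1%:R * c k.+1.

Lemma subexponential_deriv c :
  subexponential c -> subexponential (deriv_coef c).
Proof.
by move=> hc; exact: (subexponential_shift (subexponential_mulk hc)).
Qed.

Lemma power_sum_cvg c z : subexponential c -> nm z < 1 ->
  series (fun k => c k * z ^+ k) @ \oo --> power_sum c z.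
Proof. exact: cvg_power_series. Qed.

Lemma series_deriv_coefE c (z : C) N :
  series (fun k => c k * (k%:R * z ^+ k.-1)) N.+1
  = series (fun k => deriv_coef c k * z ^+ k) N.
Proof.
rewrite /series /= big_nat_recl//= mul0r mulr0 add0r.
by apply: eq_bigr => k _; rewrite /deriv_coef mulrCA mulrA.
Qed.

Lemma power_sum_deriv_cvg c (z : C) : subexponential c -> nm z < 1 ->
  series (fun k => c k * (k%:R * z ^+ k.-1)) @ \oo
    --> power_sum (deriv_coef c) z.
Proof.
move=> hc z1; rewrite -cvg_shiftS.
have -> : [sequence series (fun k => c k * (k%:R * z ^+ k.-1)) n.+1]_n
    = series (fun k => deriv_coef c k * z ^+ k).
  by apply/funext => n; exact: series_deriv_coefE.
exact: power_sum_cvg (subexponential_deriv hc) z1.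
Qed.

(** Summing [power_remainder] against the coefficients, the bound is a
    convergent geometric series because [k ^ 2 c_k] is again subexponential.
    The bound for partial sums passes to the limit. *)
Lemma power_sum_remainder c (z : C) : subexponential c -> nm z < 1 ->
  exists M d : R, 0 < d /\ forall h : C, nm h < d ->
    nm (power_sum c (z + h) - power_sum c z - h * power_sum (deriv_coef c) z)
      <= M * nm h ^+ 2.
Proof.
move=> hc z1; have z0 := nm_ge0 z.
pose r := (nm z + 1) / 2; pose s := (r + 1) / 2; pose d := (1 - nm z) / 2.
have zr : nm z <= r by rewrite /r; lra.
have r0 : 0 < r by rewrite /r; lra.
have r1 : r < 1 by rewrite /r; lra.
have s0 : 0 < s by rewrite /s; lra.
have [|M cM] := subexponential_mulk (subexponential_mulk hc) (s := s).
  by rewrite /s; lra.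
have M0 : 0 <= M by have := cM 0; rewrite expr0 mulr1; apply: le_trans; exact: nm_ge0.
pose q := r / s.
have q01 : 0 <= q < 1.
  by rewrite /q divr_ge0 ?ltW//= ltr_pdivrMr// mul1r /s; lra.
have /andP[q0 q1] := q01.
(* [d] keeps [z + h] in the disc of radius [r < s < 1]; [q] is the ratio of
   the dominating series *)
exists (M / (1 - q) / r ^+ 2), d; split; first by rewrite /d; lra.
move=> h hd.
have zhr : nm (z + h) <= r.
  by apply: le_trans (le_normcD _ _) _; move: hd; rewrite /d /r; lra.
have zh1 : nm (z + h) < 1 by exact: le_lt_trans zhr r1.
pose u k := c k * ((z + h) ^+ k - z ^+ k - h * (k%:R * z ^+ k.-1)).
apply: (@nm_lim_le (series u)).
  have -> : series u = series (fun k => c k * (z + h) ^+ k)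
      - series (fun k => c k * z ^+ k)
      - h *: series (fun k => c k * (k%:R * z ^+ k.-1)).
    apply/funext => n; rewrite /series !fctE /= scaler_sumr -!sumrB.
    by apply: eq_bigr => k _; rewrite /u !mulrBr [h *: _]mulrCA.
  apply: cvgB; last by apply: cvgZr; exact: power_sum_deriv_cvg.
  by apply: cvgB; exact: power_sum_cvg.
move=> n; apply: le_trans (nm_sum _ _) _.
have -> : M / (1 - q) / r ^+ 2 * nm h ^+ 2 = M / (1 - q) * (nm h ^+ 2 / r ^+ 2).
  by rewrite mulrAC -mulrA.
have rr : 0 < r ^+ 2 by rewrite exprn_gt0.
apply: le_trans (_ : \sum_(0 <= k < n) (M * q ^+ k) * (nm h ^+ 2 / r ^+ 2) <= _).
  apply: ler_sum => k _; rewrite mulrA ler_pdivlMr// /u normcM.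
  have := power_remainder k zr zhr; set X := nm (_ - _ - _) => le.
  rewrite -[leLHS]mulrA [X * _]mulrC.
  apply: le_trans (ler_wpM2l (nm_ge0 _) le) _.
  rewrite mulrA ler_wpM2r ?exprn_ge0 ?nm_ge0//.
  rewrite [q ^+ k]expr_div_n [leRHS]mulrA ler_pdivlMr ?exprn_gt0//.
  have := cM k; rewrite !normcM nm_nat => le2.
  apply: le_trans (_ : (k%:R * (k%:R * nm (c k)) * s ^+ k) * r ^+ k <= _); first by lra.
  by rewrite ler_wpM2r // exprn_ge0 ?ltW.
rewrite -mulr_suml ler_wpM2r ?geometric_sum_le//.
by rewrite divr_ge0 ?exprn_ge0 ?nm_ge0 ?ltW.
Qed.

Lemma gbinom_recr (a : C) k : k.+1%:R * gbinom a k.+1 = (a - k%:R) * gbinom a k.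
Proof.
rewrite /gbinom big_ord_recr /=.
by rewrite mulrCA mulrC [_%:R * _]mulrC mulfVK ?pnatr_eq0.
Qed.

(** The ratio of consecutive terms of [|c_k| s ^ k] is at most
    [s (|a| + k) / (k + 1)], hence at most 1 from some index on. *)
Lemma gbinom_subexponential (a : C) : subexponential (gbinom a).
Proof.
move=> s /andP[s0 s1]; pose u k := nm (gbinom a k) * s ^+ k.
have u0 k : 0 <= u k by rewrite mulr_ge0 ?nm_ge0// exprn_ge0// ltW.
have [K0 hK] : exists K0 : nat, (nm a + 1) / (1 - s) <= K0%:R.
  exists (Num.bound ((nm a + 1) / (1 - s))); apply/ltW/archi_boundP.
  by rewrite divr_ge0 ?subr_ge0 ?addr_ge0 ?nm_ge0 ?ltW.
exists (\sum_(0 <= k < K0.+1) u k) => k.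
have step j : (K0 <= j)%N -> u j.+1 <= u j.
  move=> K0j; rewrite /u exprS mulrA.
  rewrite ler_wpM2r ?exprn_ge0 ?(ltW s0)//.
  rewrite -(ler_pM2l (_ : 0 < j.+1%:R))// mulrA -nm_nat.
  rewrite -normcM gbinom_recr normcM nm_nat.
  rewrite mulrAC ler_wpM2r ?nm_ge0//.
  have Kj : (K0%:R : R) <= j%:R by rewrite ler_nat.
  have aj : nm (a - j%:R) <= nm a + j%:R.
    by apply: le_trans (le_normcD _ _) _; rewrite normcN nm_nat.
  move: hK; rewrite ler_pdivrMr ?subr_gt0// -natr1.
  have : 0 <= (nm a + j%:R - nm (a - j%:R)) * s by rewrite mulr_ge0 ?subr_ge0 ?(ltW s0).
  have : 0 <= (j%:R - K0%:R) * (1 - s) by rewrite mulr_ge0 ?subr_ge0 ?(ltW s1).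
  have : 0 <= nm a * (1 - s) by rewrite mulr_ge0 ?subr_ge0 ?nm_ge0 ?(ltW s1).
  lra.
have [kK|Kk] := leqP k K0.
  rewrite (bigD1_seq k) ?mem_index_iota ?iota_uniq//= lerDl.
  by apply: sumr_ge0.
have : u k <= u K0.
  rewrite -(subnKC (ltnW Kk)); elim: (k - K0)%N => [|j IH]; first by rewrite addn0.
  by rewrite addnS; apply: le_trans (step _ _) IH; rewrite leq_addr.
move=> /le_trans; apply.
by rewrite big_nat_recr//= lerDr; apply: sumr_ge0.
Qed.

(** The recurrence [(k + 1) c_(k+1) + k c_k = a c_k], read on partial sums. *)
Lemma binomial_series_ode (a z : C) : nm z < 1 ->
  (1 + z) * power_sum (deriv_coef (gbinom a)) z = a * power_sum (gbinom a) z.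
Proof.
move=> z1; have hc := gbinom_subexponential a.
have c1 := power_sum_cvg hc z1.
have c2 := power_sum_cvg (subexponential_deriv hc) z1.
have c3 := power_sum_deriv_cvg hc z1.
have l1 : (fun n => series (fun k => deriv_coef (gbinom a) k * z ^+ k) n
   + z * series (fun k => gbinom a k * (k%:R * z ^+ k.-1)) n) @ \oo
   --> power_sum (deriv_coef (gbinom a)) z + z * power_sum (deriv_coef (gbinom a)) z.
  exact: (cvgD c2 (cvgM (cvg_cst z) c3)).
have l2 : (fun n => a * series (fun k => gbinom a k * z ^+ k) n) @ \oo
   --> a * power_sum (gbinom a) z by exact: (cvgM (cvg_cst a) c1).
rewrite mulrDl mul1r -(cvg_lim (@norm_hausdorff _ _) l1).
rewrite -(cvg_lim (@norm_hausdorff _ _) l2); congr (lim (_ @ \oo)).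
apply/funext => n; rewrite /series /= !mulr_sumr -big_split /=.
apply: eq_bigr => k _; rewrite /deriv_coef gbinom_recr.
by case: k => [|k]; rewrite ?exprS /=; ring.
Qed.

(** * Derivatives of the kernel *)

(** All functions to be differentiated restrict to affine functions of the
    parameter on a coordinate line; this is the only form of the chain rule
    that the kernel requires. *)
Definition affine_along (V : normedModType C) (w : V -> C) (x v : V) (b : C) :=
  forall h : C, w (h *: v + x) = w x + h * b.

Lemma is_derive_affine (V : normedModType C) (w : V -> C) x v b :
  affine_along w x v b -> is_derive x v w b.
Proof.
move=> wb.
suff cv : h^-1 *: ((w \o shift x) (h *: v) - w x) @[h --> 0^'] --> b.
  by apply: DeriveDef; [exact: cvgP cv | exact: cvg_lim cv].
apply/cvgrPdist_lt => e e0; exists 1 => //= h _ h0.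
by rewrite /GRing.scale /= wb addrAC subrr add0r mulKf// subrr normr0.
Qed.

Lemma is_derive_inv (V : normedModType C) (f : V -> C) x v d :
  f x != 0 -> is_derive x v f d ->
  is_derive x v (fun z => (f z)^-1) (- (f x) ^- 2 * d).
Proof.
move=> fx [df <-]; apply: DeriveDef; first exact: derivableV.
exact: deriveV.
Qed.

Lemma ppowE (w a : C) : ppow w a = power_sum (gbinom a) (w - 1).
Proof. by []. Qed.

(** The quadratic remainder of the binomial series gives the limit of the
    difference quotient, and the differential equation identifies it. *)
Lemma is_derive_ppow (V : normedModType C) (w : V -> C) x v b a :
  affine_along w x v b -> nm (w x - 1) < 1 ->
  is_derive x v (fun z => ppow (w z) a) (a * (b / w x) * ppow (w x) a).
Proof.
move=> wb w1; set z := w x - 1 in w1; have hc := gbinom_subexponential a.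
have wz : w x = 1 + z by rewrite /z addrCA subrr addr0.
have w0 : 1 + z != 0.
  apply: contraTneq w1 => /eqP; rewrite addrC addr_eq0 => /eqP ->.
  by rewrite normcN normc1 ltxx.
have E : a * (b / w x) * ppow (w x) a = b * power_sum (deriv_coef (gbinom a)) z.
  rewrite ppowE -/z.
  rewrite -[a * _ * _]mulrA [_ * power_sum _ z]mulrC mulrA.
  by rewrite -binomial_series_ode// wz mulrC -!mulrA; congr (b * _); rewrite mulKf.
have [M [d [d0 rem]]] := power_sum_remainder hc w1.
suff cv : h^-1 *: (((fun z => ppow (w z) a) \o shift x) (h *: v) - ppow (w x) a)
    @[h --> 0^'] --> a * (b / w x) * ppow (w x) a.
  by apply: DeriveDef; [exact: cvgP cv | exact: cvg_lim cv].
rewrite E; apply/cvgrPdist_lt => e; rewrite ltcE => /andP[/eqP/= eI eR].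
have -> : e = (Re e)%:C by apply/eqP; rewrite eq_complex /= eqxx -eI /= eqxx.
pose B := nm b + 1; pose A := `|M| * B ^+ 2 + 1.
have B0 : 0 < B by rewrite ltr_wpDl ?nm_ge0.
have A0 : 0 < A by rewrite ltr_wpDl// mulr_ge0// exprn_ge0// ltW.
(* [d / B] keeps the increment inside the range of the remainder bound and
   [Re e / A] makes the remainder, divided by the modulus of [h], less than [e] *)
pose r := Num.min (d / B) (Re e / A).
have r0 : 0 < r by rewrite lt_min !divr_gt0.
exists r%:C; first by rewrite /= ltcR.
move=> h /=; rewrite sub0r normrN normE ltcR lt_min => /andP[hd he] h0.
have hn : 0 < nm h by rewrite -ltcR -normE normr_gt0.
have hbB : nm (h * b) <= nm h * B by rewrite normcM ler_wpM2l ?nm_ge0// lerDl.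
have hbd : nm (h * b) < d.
  by apply: le_lt_trans hbB _; rewrite -ltr_pdivlMr.
have := rem _ hbd; rewrite normE ltcR /=.
have -> : ppow (w (h *: v + x)) a = power_sum (gbinom a) (z + h * b).
  by rewrite ppowE wb addrAC.
rewrite (ppowE (w x)) -/z.
set X := power_sum _ _; set Y := power_sum _ _; set Z := power_sum _ _ => le.
have -> : b * Z - h^-1 *: (X - Y) = - (h^-1 * (X - Y - h * b * Z)).
  by rewrite [in RHS]mulrBr -[h * b * Z]mulrA mulKf// opprB.
rewrite normcN normcM normcV mulrC ltr_pdivrMr//.
apply: le_lt_trans le _.
apply: le_lt_trans (_ : `|M| * (nm h * B) ^+ 2 < _).
  apply: le_trans (ler_wpM2r _ (ler_norm M)) _; first by rewrite exprn_ge0 ?nm_ge0.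
  by rewrite ler_wpM2l// lerXn2r// nnegrE ?mulr_ge0 ?nm_ge0// ltW.
rewrite exprMn mulrCA mulrC [nm h ^+ 2]expr2 mulrA ltr_pM2r//.
move: he; rewrite ltr_pdivlMr// => he.
by apply: le_lt_trans he; rewrite mulrC ler_wpM2l ?ltW// /A ltrDl.
Qed.

(** Logarithmic derivatives add up; the multiplicative form of the hypothesis
    covers vanishing factors. *)
Lemma is_derive_bigprod (V : normedModType C) (I : Type) (r : seq I)
    (f : I -> V -> C) (u : I -> C) x v :
  (forall i, is_derive x v (f i) (u i * f i x)) ->
  is_derive x v (fun z => \prod_(i <- r) f i z)
    ((\sum_(i <- r) u i) * \prod_(i <- r) f i x).
Proof.
move=> fu; elim: r => [|i r IH].
  under eq_fun do rewrite big_nil.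
  by rewrite !big_nil mul0r; exact: is_derive_cst.
have -> : (fun z => \prod_(j <- i :: r) f j z)
    = f i * (fun z => \prod_(j <- r) f j z).
  by apply/funext => z; rewrite big_cons.
apply: is_derive_eq; rewrite !big_cons /GRing.scale /=; ring.
Qed.

Lemma is_derive_bigsum (V : normedModType C) (I : Type) (r : seq I)
    (f : I -> V -> C) (u : I -> C) x v :
  (forall i, is_derive x v (f i) (u i)) ->
  is_derive x v (fun z => \sum_(i <- r) f i z) (\sum_(i <- r) u i).
Proof.
move=> fu; elim: r => [|i r IH].
  under eq_fun do rewrite big_nil.
  by rewrite big_nil; exact: is_derive_cst.
have -> : (fun z => \sum_(j <- i :: r) f j z)
    = f i + (fun z => \sum_(j <- r) f j z).
  by apply/funext => z; rewrite big_cons.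
by rewrite big_cons; exact: is_deriveD (fu i) IH.
Qed.

Definition kernel_exponent (theta : C) n m N M (i : 'I_N) (j : 'I_M) : C :=
  (- theta) ^ (1 - (parity n i)%:Z - (parity m j)%:Z).

Definition in_domain N M (x : 'rV[C]_N) (y : 'rV[C]_M) :=
  forall i j, `|x 0 i * y 0 j| < 1.

Definition kernel_log_deriv (theta : C) n nt m mt
    (y : 'rV[C]_(m + mt)) (i : 'I_(n + nt))
    (x : 'rV[C]_(n + nt)) : C :=
  \sum_j - kernel_exponent theta n m i j * (y 0 j / (1 - x 0 i * y 0 j)).

Section Fixed.
Variables (theta : C) (n nt m mt : nat).
Variable y : 'rV[C]_(m + mt).
Implicit Type x : 'rV[C]_(n + nt).

Lemma affine_coord x i i' :
  affine_along (fun z : 'rV[C]_(n + nt) => z 0 i') x (delta_mx 0 i) (i' == i)%:R.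
Proof. by move=> h; rewrite !mxE eqxx addrC. Qed.

Lemma affine_factor x i i' j :
  affine_along (fun z : 'rV[C]_(n + nt) => 1 - z 0 i' * y 0 j) x (delta_mx 0 i)
    (- ((i' == i)%:R * y 0 j)).
Proof. by move=> h; rewrite affine_coord; ring. Qed.

Lemma factor_neq0 x i j : in_domain x y -> 1 - x 0 i * y 0 j != 0.
Proof.
by move=> xy; rewrite subr_eq0; apply: contraTneq (xy i j) => <-; rewrite normr1 ltxx.
Qed.

Lemma is_derive_kernel x i : in_domain x y ->
  is_derive x (delta_mx 0 i) (fun x' => Pi_kernel theta x' y)
    (kernel_log_deriv theta y i x * Pi_kernel theta x y).
Proof.
move=> xy; rewrite /Pi_kernel.
pose u i' j := - kernel_exponent theta n m i' j
  * ((i' == i)%:R * y 0 j / (1 - x 0 i' * y 0 j)).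
have -> : kernel_log_deriv theta y i x = \sum_i' \sum_j u i' j.
  rewrite (bigD1 i)//= [X in _ + X]big1 ?addr0 => [|i' /negPf ii'].
    by apply: eq_bigr => j _; rewrite /u eqxx mul1r.
  by apply: big1 => j _; rewrite /u ii' !mul0r mulr0.
apply: is_derive_bigprod => i'; apply: is_derive_bigprod => j.
have xy1 : nm (1 - x 0 i' * y 0 j - 1) < 1.
  rewrite addrAC subrr add0r normcN -ltcR; exact: xy.
apply: is_derive_eq (is_derive_ppow _ (affine_factor x i i' j) xy1) _.
by rewrite /u /kernel_exponent; ring.
Qed.

Lemma is_derive_kernel_log_deriv x i : in_domain x y ->
  is_derive x (delta_mx 0 i) (kernel_log_deriv theta y i)
    (\sum_j - kernel_exponent theta n m i j * (y 0 j / (1 - x 0 i * y 0 j)) ^+ 2).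
Proof.
move=> xy; apply: is_derive_bigsum => j.
have d := is_derive_inv (f := fun z : 'rV[C]_(n + nt) => 1 - z 0 i * y 0 j)
  (factor_neq0 i j xy) (is_derive_affine (affine_factor x i i j)).
have -> : (fun z : 'rV[C]_(n + nt) =>
      - kernel_exponent theta n m i j * (y 0 j / (1 - z 0 i * y 0 j)))
    = (- kernel_exponent theta n m i j * y 0 j) \*: (fun z => (1 - z 0 i * y 0 j)^-1).
  by apply/funext => z; rewrite /GRing.scale /= mulrA.
apply: is_derive_eq (is_deriveZ _ d) _.
by rewrite eqxx /GRing.scale /= -exprVn; ring.
Qed.

(** A second derivative needs the first one on a whole neighborhood. *)
Lemma in_domain_near x : in_domain x y -> \near x, in_domain x y.
Proof.
move=> xy; rewrite /in_domain.
apply: (@filter_forall 'rV[C]_(n + nt) _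
  (fun i z => forall j, `|z 0 i * y 0 j| < 1) (nbhs x) (nbhs_filter x)) => i.
apply: (@filter_forall 'rV[C]_(n + nt) _
  (fun j z => `|z 0 i * y 0 j| < 1) (nbhs x) (nbhs_filter x)) => j.
have c : (fun x' : 'rV[C]_(n + nt) => x' 0 i * y 0 j) x' @[x' --> x] --> x 0 i * y 0 j.
  exact: cvgM (@coord_continuous C 1 (n + nt) 0 i x) (cvg_cst _).
exact: (cvgr_norm_lt _ c _ (xy i j)).
Qed.

Lemma partial_kernel x i : in_domain x y ->
  partial i (fun x' => Pi_kernel theta x' y) x
  = kernel_log_deriv theta y i x * Pi_kernel theta x y.
Proof. by move=> /is_derive_kernel -/(_ i) d; exact: derive_val. Qed.

(** If [f' = u f] near a point, then [f'' = (u ^ 2 + u') f] there. *)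
Lemma partial2_kernel x i : in_domain x y ->
  partial i (partial i (fun x' => Pi_kernel theta x' y)) x
  = (kernel_log_deriv theta y i x ^+ 2
     + \sum_j - kernel_exponent theta n m i j * (y 0 j / (1 - x 0 i * y 0 j)) ^+ 2)
    * Pi_kernel theta x y.
Proof.
move=> xy.
have d : is_derive x (delta_mx 0 i)
    (kernel_log_deriv theta y i * (fun x' => Pi_kernel theta x' y))
     ((kernel_log_deriv theta y i x ^+ 2
     + \sum_j - kernel_exponent theta n m i j * (y 0 j / (1 - x 0 i * y 0 j)) ^+ 2)
    * Pi_kernel theta x y).
  have := is_deriveM (is_derive_kernel_log_deriv i xy) (is_derive_kernel i xy).
  by move=> /is_derive_eq; apply; rewrite /GRing.scale /=; ring.
have e : \near x, (kernel_log_deriv theta y i * (fun x' => Pi_kernel theta x' y)) x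
   = partial i (fun x' => Pi_kernel theta x' y) x.
  by apply: filterS (in_domain_near xy) => x' xy'; rewrite partial_kernel.
by have [_ <-] := near_eq_is_derive e d.
Qed.

End Fixed.

(** * Weights *)

Section Weights.
Variables (theta : C) (theta_neq0 : theta != 0).
Local Notation t := (- theta).

(** The weight takes the values [t] and [1] on the two kinds of variables, the
    roots of [(b - 1) (b - t) = 0]; this is the source of
    [t / b = 1 + t - b]. *)
Definition weight (n N : nat) (i : 'I_N) : C := t ^+ (1 - parity n i).

Lemma weight_neq0 n N (i : 'I_N) : weight n i != 0.
Proof. by rewrite expf_neq0 ?oppr_eq0. Qed.

Lemma weight_parity n N (i : 'I_N) : t ^+ parity n i = t / weight n i.
Proof.
by rewrite /weight /parity; case: (n <= i)%N; rewrite ?expr0 ?expr1 ?divr1 ?divff ?oppr_eq0.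
Qed.

Lemma weight_quad n N (i : 'I_N) : t / weight n i = 1 + t - weight n i.
Proof.
rewrite /weight /parity; case: (n <= i)%N; rewrite ?expr0 ?expr1 ?divr1 ?divff ?oppr_eq0//; ring.
Qed.

Lemma kernel_exponent_weight n N m M (i : 'I_N) (j : 'I_M) :
  kernel_exponent theta n m i j = weight n i * weight m j / t.
Proof.
rewrite /kernel_exponent /weight /parity; case: (n <= i)%N; case: (m <= j)%N => /=.
- by rewrite !expr0 mul1r div1r -exprN1.
- by rewrite expr0 expr1 mul1r divff ?oppr_eq0// expr0z.
- by rewrite expr0 expr1 mulr1 divff ?oppr_eq0// expr0z.
- by rewrite !expr1 mulfK ?oppr_eq0// expr1z.
Qed.

Lemma sum_weight n nt : \sum_(i < n + nt) weight n i = - sdim theta n nt.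
Proof.
rewrite big_split_ord /=.
under eq_bigr do rewrite /weight /parity /= leqNgt ltn_ord expr1.
under [X in _ + X]eq_bigr do rewrite /weight /parity /= leq_addr expr0.
by rewrite !sumr_const !card_ord /sdim -[t *+ n]mulr_natr; ring.
Qed.

Lemma dpsum_weight m mt r (y : 'rV[C]_(m + mt)) :
  dpsum theta r y = (\sum_j weight m j * y 0 j ^+ r) / t.
Proof.
rewrite big_split_ord /= mulrDl /dpsum; congr (_ + _).
  rewrite mulr_suml; apply: eq_bigr => j _.
  rewrite /weight /parity /= leqNgt ltn_ord expr1.
  by rewrite mulrAC divff ?mul1r ?oppr_eq0.
rewrite mulr_suml mulr_sumr -sumrN; apply: eq_bigr => j _.
by rewrite /weight /parity /= leq_addr expr0 mul1r invrN; ring.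
Qed.

End Weights.

Section Assemble.
Variables (theta : C) (theta_neq0 : theta != 0).
Local Notation t := (- theta).

Lemma kernelC n nt m mt (x : 'rV[C]_(n + nt)) (y : 'rV[C]_(m + mt)) :
  Pi_kernel theta x y = Pi_kernel theta y x.
Proof.
rewrite /Pi_kernel exchange_big; apply: eq_bigr => j _; apply: eq_bigr => i _.
by rewrite mulrC addrAC.
Qed.

Section Left.
Variables (n nt m mt : nat) (x : 'rV[C]_(n + nt)) (y : 'rV[C]_(m + mt)).
Hypothesis xy : in_domain x y.
Local Notation b := (fun i : 'I_(n + nt) => weight theta n i).
Local Notation d := (fun j : 'I_(m + mt) => weight theta m j).
Local Notation LD := (log_deriv t b d (x 0) (y 0)).
Local Notation PI := (Pi_kernel theta x y).

Lemma kernel_log_derivE i : kernel_log_deriv theta y i x = LD i.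
Proof. by apply: eq_bigr => j _; rewrite kernel_exponent_weight. Qed.

Lemma partial_log_deriv i :
  partial i (fun x' => Pi_kernel theta x' y) x = LD i * PI.
Proof. by rewrite partial_kernel// kernel_log_derivE. Qed.

(** Applied to [(y, x)] in place of [(x, y)], this also computes the
    corresponding part of the dual operator. *)
Lemma second_order_side_kernel k :
  \sum_i t ^+ parity n i * x 0 i ^+ k
     * partial i (partial i (fun x' => Pi_kernel theta x' y)) x
  - 2 * \sum_i \sum_(j | j != i)
      t ^+ (1 - parity n j) * (x 0 i ^+ k / (x 0 i - x 0 j))
      * partial i (fun x' => Pi_kernel theta x' y) x
  = second_order_side t b d (x 0) (y 0) k * PI.
Proof.
rewrite /second_order_side mulrBl; congr (_ - _).
  rewrite mulr_suml; apply: eq_bigr => i _.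
  rewrite partial2_kernel// kernel_log_derivE weight_parity// -!mulrA.
  congr (_ * (_ * (_ * ((_ + _) * _)))).
  by apply: eq_bigr => j _; rewrite kernel_exponent_weight.
rewrite -mulrA mulr_suml; congr (_ * _); apply: eq_bigr => i _.
rewrite mulr_suml; apply: eq_bigr => j _.
by rewrite partial_log_deriv !mulrA.
Qed.

End Left.

Lemma in_domainC n nt m mt (x : 'rV[C]_(n + nt)) (y : 'rV[C]_(m + mt)) :
  in_domain x y -> in_domain y x.
Proof. by move=> xy j i; rewrite mulrC. Qed.

Section Right.
Variables (n nt m mt : nat) (x : 'rV[C]_(n + nt)) (y : 'rV[C]_(m + mt)).
Hypothesis xy : in_domain x y.
Hypothesis x_distinct : forall i j, i != j -> x 0 i != x 0 j.
Hypothesis y_distinct : forall i j, i != j -> y 0 i != y 0 j.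

Lemma kernel_funC : (fun y' : 'rV[C]_(m + mt) => Pi_kernel theta x y')
  = (fun y' => Pi_kernel theta y' x).
Proof. by apply/funext => y'; exact: kernelC. Qed.

Lemma D_kernel k : (k < 3)%N ->
  D_op theta k (fun x' => Pi_kernel theta x' y) x
  = Dbar_op theta n nt k (fun y' => Pi_kernel theta x y') y.
Proof.
move=> k3; rewrite kernel_funC /D_op /Dbar_op.
rewrite !second_order_side_kernel//; last exact: in_domainC.
rewrite [Pi_kernel theta y x]kernelC.
have t0 : t != 0 by rewrite oppr_eq0.
have := @second_order_duality _ _ _ t _ _ (x 0) (y 0) k k3 t0
  (@weight_neq0 _ theta_neq0 n (n + nt)) (@weight_quad _ theta_neq0 n (n + nt))
  (@weight_neq0 _ theta_neq0 m (m + mt)) (@weight_quad _ theta_neq0 m (m + mt))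
  x_distinct y_distinct (fun i j => factor_neq0 i j xy).
rewrite /= !sum_weight => H.
transitivity ((second_order_side t (weight theta n (N := n + nt))
      (weight theta m (N := m + mt)) (x 0) (y 0) k
   + k%:R * \sum_i (1 - weight theta n i) * x 0 i ^+ k.-1
       * log_deriv t (weight theta n (N := n + nt))
           (weight theta m (N := m + mt)) (x 0) (y 0) i) * Pi_kernel theta x y).
  rewrite [RHS]mulrDl -[k%:R * _ * _]mulrA [in RHS]mulr_suml.
  congr (_ + _ * _); apply: eq_bigr => i _.
  by rewrite partial_log_deriv// -!mulrA.
rewrite H [LHS]mulrDl [X in X + _ = _]mulrDl mulr_suml.
congr (_ + _ + _).
  apply: eq_bigr => j _; rewrite partial_log_deriv; last exact: in_domainC.
  rewrite [Pi_kernel theta y x]kernelC !mulrA; congr (_ * _ * _ * _).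
  by rewrite /Dbar_coef weight_parity// weight_quad// /weight; ring.
congr (_ * _); rewrite /Dbar_pot !dpsum_weight//.
by field.
Qed.

Lemma E_kernel l : (l < 2)%N ->
  E_op l (fun x' => Pi_kernel theta x' y) x
  = Ebar_op theta n nt l (fun y' => Pi_kernel theta x y') y.
Proof.
move=> l2; rewrite kernel_funC /E_op /Ebar_op.
under eq_bigr do rewrite partial_log_deriv// mulrA.
under [X in _ = X + _]eq_bigr do rewrite (partial_log_deriv (in_domainC xy)) mulrA.
rewrite -!mulr_suml [Pi_kernel theta y x]kernelC -mulrDl; congr (_ * _).
rewrite (first_order_duality _ _ l2)//; last first.
- by move=> i j; exact: factor_neq0.
- by rewrite oppr_eq0.
rewrite sum_weight opprK dpsum_weight// mulr_suml -mulrA; congr (_ + _ * (_ * _)).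
Qed.

End Right.
End Assemble.
End ComplexKernel.

Theorem proposition4p1 (R : realType) (n nt m mt : nat) (theta : R)
    (theta_neq0 : theta != 0) (alpha : 'I_3 -> R) (beta : 'I_2 -> R)
    (x : 'rV[R[i]]_(n + nt)) (y : 'rV[R[i]]_(m + mt))
    (x_distinct : forall i j : 'I_(n + nt), i != j -> x 0 i != x 0 j)
    (y_distinct : forall j l : 'I_(m + mt), j != l -> y 0 j != y 0 l)
    (xy_lt1 : forall (i : 'I_(n + nt)) (j : 'I_(m + mt)),
       `|x 0 i * y 0 j| < 1) :
  L_op theta%:C (fun k => (alpha k)%:C) (fun l => (beta l)%:C)
    (fun x' => Pi_kernel theta%:C x' y) x
  = Lbar_op theta%:C (fun k => (alpha k)%:C) (fun l => (beta l)%:C) n nt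
    (fun y' => Pi_kernel theta%:C x y') y.
Proof.
have t0 : theta%:C != 0 by apply: contraNneq theta_neq0 => /complexI ->.
rewrite /L_op /Lbar_op; congr (_ + _); apply: eq_bigr => k _; congr (_ * _).
  exact: D_kernel.
exact: E_kernel.
Qed.
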